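(* Let $G$ be an Abelian group, let $A,B \subset G$ be finite non-empty sets, let $K$ be a real number with $|A+B| \leq K|B|$, and let $\delta \in (0,1]$. Then there is a set $X \subset A$ with $|X| \leq \delta^{-1}(K-1)+1$ such that $$|(x+B) \cap (X+B)| \geq (1-\delta)|B| \quad \text{for all } x \in A.$$
   Context: For subsets $S,T$ of an Abelian group, $S+T:=\{s+t: s \in S, t\in T\}$, and $x+B:=\{x+b: b \in B\}$. *)

(* Defs.v *)
From mathcomp Require Import all_boot all_order all_algebra finmap.

Set Implicit Arguments.
Unset Strict Implicit.
Unset Printing Implicit Defensive.

Local Open Scope fset_scope.
Local Open Scope ring_scope.

Definition sumset (G : zmodType) (S T : {fset G}) : {fset G} :=
  [fset s + t | s in S, t in T].

Definition translate (G : zmodType) (x : G) (B : {fset G}) : {fset G} :=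
  [fset x + b | b in B].

(* Main.v *)
(** Greedy choice: start from one point of [A] and keep adding points [x] of
    [A] for which [x + B] meets [X + B] in fewer than [(1 - delta) |B|] points.
    Each step adds more than [delta |B|] points to [X + B], which stays inside
    [A + B], so the number of steps is at most [(K - 1) / delta]. *)
Require Import Defs.
From mathcomp Require Import all_boot all_order all_algebra finmap reals.
From mathcomp Require Import lra.

Set Implicit Arguments.
Unset Strict Implicit.
Unset Printing Implicit Defensive.

Import Order.TTheory GRing.Theory Num.Theory.

Local Open Scope fset_scope.
Local Open Scope ring_scope.

Lemma card_translate (G : zmodType) (x : G) (B : {fset G}) :
  #|` translate x B| = #|` B|.
Proof. by rewrite /translate card_imfset //; apply: addrI. Qed.

Lemma sumsetS (G : zmodType) (S T B : {fset G}) :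
  S `<=` T -> sumset S B `<=` sumset T B.
Proof.
move=> /fsubsetP sST; apply/fsubsetP => _ /imfset2P[s /= sS [b /= bB ->]].
by apply/imfset2P; exists s; [apply: sST | exists b].
Qed.

Lemma sumset1 (G : zmodType) (x : G) (B : {fset G}) :
  sumset [fset x] B = translate x B.
Proof.
apply/fsetP => z; apply/imfset2P/imfsetP => /=.
  by case=> _ /fset1P-> [b bB ->]; exists b.
by case=> b bB ->; exists x; [rewrite inE | exists b].
Qed.

Lemma sumsetU1 (G : zmodType) (x : G) (X B : {fset G}) :
  sumset (x |` X) B = translate x B `|` sumset X B.
Proof.
apply/eqP; rewrite eqEfsubset fsubUset -{2}sumset1.
rewrite !sumsetS ?fsubsetUl ?fsubsetUr //.
rewrite !andbT; apply/fsubsetP => _ /imfset2P[s /= sX [b /= bB ->]].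
apply/fsetUP; case/fset1UP: sX => [->|sX].
  by left; apply: in_imfset.
by right; apply/imfset2P; exists s => //; exists b.
Qed.

(** Inclusion-exclusion for the two pieces [x + B] and [X + B], kept additive to avoid truncated
    subtraction in [nat]. *)
Lemma card_sumsetU1 (G : zmodType) (x : G) (X B : {fset G}) :
  (#|` sumset (x |` X) B| + #|` translate x B `&` sumset X B|
   = #|` B| + #|` sumset X B|)%N.
Proof.
by rewrite sumsetU1 cardfsUI card_translate.
Qed.

(** For [x] in [X] the translate lies inside [X + B], so the intersection is all of [x + B]. *)
Lemma saturated_mem (R : realDomainType) (G : zmodType) (X B : {fset G})
    (delta : R) (x : G) :
  0 <= delta -> x \in X -> (1 - delta) * (#|` B|)%:R
    <= (#|` translate x B `&` sumset X B|)%:R.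
Proof.
move=> d0 xX; rewrite (fsetIidPl _); last by rewrite -sumset1 sumsetS ?fsub1set.
by rewrite card_translate ler_piMl ?ler0n // gerBl.
Qed.

(** Induction on [n], a bound for the number of points of [A] still outside [X]. The lower bound on
    [X + B] is the greedy invariant: it allots [|B|] to the first point and [delta * |B|] to each
    later one. *)
Lemma exists_saturated (R : realDomainType) (G : zmodType) (A B X : {fset G})
    (delta : R) (n : nat) :
  0 <= delta -> (#|` A| <= #|` X| + n)%N -> X `<=` A ->
  (1 + delta * ((#|` X|)%:R - 1)) * (#|` B|)%:R <= (#|` sumset X B|)%:R ->
  exists Y : {fset G},
    [/\ Y `<=` A,
        (1 + delta * ((#|` Y|)%:R - 1)) * (#|` B|)%:R <= (#|` sumset Y B|)%:R
      & forall x, x \in A -> (1 - delta) * (#|` B|)%:R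
          <= (#|` translate x B `&` sumset Y B|)%:R].
Proof.
move=> d0; elim: n X => [|n IHn] X leAX sXA hX.
  (* No point of [A] is left outside [X], so membership alone gives saturation. *)
  have eqXA : X = A by apply/eqP; rewrite eqEfcard sXA -[#|` X|]addn0.
  by exists X; split=> // x; rewrite -eqXA; apply: saturated_mem.
pose sat x := (1 - delta) * (#|` B|)%:R
              <= (#|` translate x B `&` sumset X B|)%:R :> R.
have [/allP satA|/allPn[x xA xNsat]] := boolP (all sat A); first by exists X.
(* An unsaturated point is new, so adding it raises [|X|] by exactly one and uses up one unit of
   [n]. *)
have xNX : x \notin X by apply: contra xNsat; apply: saturated_mem.
apply: (IHn (x |` X)).
- by rewrite cardfsU1 xNX add1n addSnnS.
- by rewrite fsubUset fsub1set xA.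
(* The overlap is below [(1 - delta) * |B|], so the sumset grows by more than [delta * |B|], as the
   invariant demands. *)
have /(congr1 (fun k => k%:R : R)) := card_sumsetU1 x X B.
move: xNsat; rewrite /sat -ltNge cardfsU1 xNX /= !natrD => lt_sat eq_card.
by lra.
Qed.

Theorem lemma2p2 (R : realType) (G : zmodType) (A B : {fset G}) (K delta : R)
    (hA : A != fset0) (hB : B != fset0)
    (hK : (#|` sumset A B|)%:R <= K * (#|` B|)%:R)
    (hdelta : 0 < delta <= 1) :
  exists X : {fset G},
    [/\ X `<=` A,
        (#|` X|)%:R <= delta^-1 * (K - 1) + 1
      & forall x : G, x \in A ->
          (1 - delta) * (#|` B|)%:R
            <= (#|` translate x B `&` sumset X B|)%:R].
Proof.
have /andP[d_gt0 _] := hdelta.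
have [a aA] := fset0Pn _ hA.
(* From a singleton the invariant starts as an equality, and [|A|] is ample as a step bound. *)
have [||||X [sXA hX satX]] := @exists_saturated R G A B [fset a] delta #|` A|.
- exact: ltW.
- exact: leq_addl.
- by rewrite fsub1set.
- by rewrite cardfs1 subrr mulr0 addr0 mul1r sumset1 card_translate.
exists X; split=> //.
have B_gt0 : 0 < (#|` B|)%:R :> R by rewrite ltr0n cardfs_gt0.
(* Clearing [delta] and multiplying by [|B| > 0] turns the goal into the invariant's left side being
   at most [K * |B|]. *)
rewrite -lerBlDr ler_pdivlMl // lerBrDl -(ler_pM2r B_gt0).
apply: le_trans hX (le_trans _ hK).
by rewrite ler_nat fsubset_leq_card // sumsetS.
Qed.
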